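(* Let $\mathcal{S}$ be a commutative semiring and $\Sigma$ a finite alphabet. For every formula $\phi\in\mathbf{RMSOL}$ (over $\mathcal{S}$ and $\Sigma$) there is an expression $tr'(\phi)\in\mathbf{MSOLEVAL}_{\mathcal{S}}$ such that $WE(\phi,w,\sigma)=E(tr'(\phi),w,\sigma)$ for every word $w$ and every assignment $\sigma$ of the free variables; i.e., $\phi$ and $tr'(\phi)$ define the same word function.
   Context: Word structures: a word $w=\sigma_1\cdots\sigma_n\in\Sigma^{\star}$ is represented by the structure $\mathcal{A}_w$ with universe $\{0,1,\dots,n\}$, the natural linear order $\le$, and unary predicates $P_a=\{i\in\{1,\dots,n\}:\sigma_i=a\}$ for $a\in\Sigma$. Variables range over positions of $w$ (first-order variables) and sets of positions (set variables); an assignment $\sigma$ maps free variables to these. $\mathbf{MSOLEVAL}_{\mathcal{S}}$ expressions: built inductively from monomials $\prod_{v:\phi(v)} r$ (with $r\in\mathcal{S}$ and $\phi$ an $\mathbf{MSOL}$ formula; value $r^{k}$ where $k$ is the number of elements $v$ satisfying $\phi$) closed under finite products of monomials and under sums $\sum_{\bar R:\phi(\bar R)} t$ over tuples $\bar R$ of subsets of the universe satisfying an $\mathbf{MSOL}$ formula $\phi$, where $t$ is an expression that may mention $\bar R$. Expressions may have free first-order and set variables occurring in their formulas; $E(t,w,\sigma)$ denotes the value in $\mathcal{S}$ of $t$ on $\mathcal{A}_w$ under assignment $\sigma$. Weighted MSOL ($\mathbf{WMSOL}$): formulas given by $\phi::= k\mid P_a(x)\mid\neg P_a(x)\mid x\le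 y\mid\neg x\le y\mid x\in X\mid x\notin X\mid\phi\vee\psi\mid\phi\wedge\psi\mid\exists x.\phi\mid\exists X.\phi\mid\forall x.\phi\mid\forall X.\phi$ with $k\in\mathcal{S}$, $a\in\Sigma$. Semantics $WE(\phi,w,\sigma)\in\mathcal{S}$: $WE(k)=k$; an atomic formula evaluates to $1$ if true and $0$ if false under $\sigma$; a negated atomic formula evaluates to $1$ if the atom is false and $0$ otherwise; $\vee$ is semiring sum, $\wedge$ semiring product; $\exists x$ (resp. $\exists X$) is the sum over all positions (resp. all sets of positions) of the value of the body; $\forall x$ (resp. $\forall X$) is the product over all positions (resp. all sets of positions) of the value of the body. $\mathbf{bMSOL}$: formulas $\phi::=0\mid1\mid P_a(x)\mid x\le y\mid x\in X\mid\neg\phi\mid\phi\wedge\psi\mid\forall x.\phi\mid\forall X.\phi$; their evaluation takes values in $\{0,1\}$ and coincides with the standard Boolean semantics of $\phi$ as an unweighted MSOL formula. A $\mathbf{bMSOL}$-step formula is a formula $\bigvee_{i\in I}(\phi_i\wedge k_i)$ with $I$ finite, $\phi_i\in\mathbf{bMSOL}$, $k_i\in\mathcal{S}$. $\mathbf{RMSOL}$ is the fragment of $\mathbf{WMSOL}$ in which universal second-order quantification $\forall X.\psi$ is allowed only for $\psi\in\mathbf{bMSOL}$ and universal first-order quantification $\forall x.\psi$ only for $\mathbf{bMSOL}$-step formulas $\psi$. *)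

(* Defs.v *)
From HB Require Import structures.
From mathcomp Require Import all_boot all_order all_algebra.

Set Implicit Arguments.
Unset Strict Implicit.
Unset Printing Implicit Defensive.

Import GRing.Theory.
Local Open Scope ring_scope.

(* The universe {0, 1, ..., n} of the structure of a word w of length n; the
   element 0 carries no letter. *)
Definition pos (Sigma : finType) (w : seq Sigma) := 'I_(size w).+1.

Definition letter_at (Sigma : finType) (w : seq Sigma) (a : Sigma) (i : pos w) :
    bool :=
  (0 < i)%N && (onth w i.-1 == Some a).

(* First-order and set variables are two disjoint copies of nat. *)
Record assignment (Sigma : finType) (w : seq Sigma) := Assignment {
  fo : nat -> pos w;
  so : nat -> {set pos w} }.

Definition upd1 (Sigma : finType) (w : seq Sigma) (s : assignment w)
    (x : nat) (i : pos w) : assignment w :=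
  Assignment (fun y => if y == x then i else fo s y) (so s).

Definition upd2 (Sigma : finType) (w : seq Sigma) (s : assignment w)
    (X : nat) (A : {set pos w}) : assignment w :=
  Assignment (fo s) (fun Y => if Y == X then A else so s Y).

Definition updn (Sigma : finType) (w : seq Sigma) (s : assignment w)
    (Rs : seq nat) (As : seq {set pos w}) : assignment w :=
  Assignment (fo s)
    (fun Y => if Y \in Rs then nth set0 As (index Y Rs) else so s Y).

Inductive msol (Sigma : finType) : Type :=
| MFalse
| MLetter (a : Sigma) (x : nat)
| MLe (x y : nat)
| MEq (x y : nat)
| MMem (x X : nat)
| MNot (p : msol Sigma)
| MAnd (p q : msol Sigma)
| MOr (p q : msol Sigma)
| MEx1 (x : nat) (p : msol Sigma)
| MEx2 (X : nat) (p : msol Sigma)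
| MAll1 (x : nat) (p : msol Sigma)
| MAll2 (X : nat) (p : msol Sigma).

Arguments MFalse {Sigma}.
Arguments MLe {Sigma} x y.
Arguments MEq {Sigma} x y.
Arguments MMem {Sigma} x X.

Fixpoint sat (Sigma : finType) (w : seq Sigma) (p : msol Sigma)
    (s : assignment w) {struct p} : bool :=
  match p with
  | MFalse => false
  | MLetter a x => letter_at a (fo s x)
  | MLe x y => (fo s x <= fo s y)%N
  | MEq x y => fo s x == fo s y
  | MMem x X => fo s x \in so s X
  | MNot p => ~~ sat p s
  | MAnd p q => sat p s && sat q s
  | MOr p q => sat p s || sat q s
  | MEx1 x p => [exists i : pos w, sat p (upd1 s x i)]
  | MEx2 X p => [exists A : {set pos w}, sat p (upd2 s X A)]
  | MAll1 x p => [forall i : pos w, sat p (upd1 s x i)]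
  | MAll2 X p => [forall A : {set pos w}, sat p (upd2 s X A)]
  end.

(* Free variables: inl x is the first-order variable x, inr X the set
   variable X. *)
Fixpoint msol_fv (Sigma : finType) (p : msol Sigma) : seq (nat + nat) :=
  match p with
  | MFalse => [::]
  | MLetter _ x => [:: inl x]
  | MLe x y | MEq x y => [:: inl x; inl y]
  | MMem x X => [:: inl x; inr X]
  | MNot p => msol_fv p
  | MAnd p q | MOr p q => msol_fv p ++ msol_fv q
  | MEx1 x p | MAll1 x p => [seq z <- msol_fv p | z != inl x]
  | MEx2 X p | MAll2 X p => [seq z <- msol_fv p | z != inr X]
  end.

(* MProd r v p is the monomial \prod_(v : p(v)) r, which binds v. *)
Inductive monomial (K : comPzSemiRingType) (Sigma : finType) : Type :=
| MProd (r : K) (v : nat) (p : msol Sigma)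
| MMul (m1 m2 : monomial K Sigma).

(* ESum Rs u p t is \sum_(Rs : p(Rs)) t, which binds the tuple of pairwise
   distinct set variables Rs in p and in t. *)
Inductive msoleval (K : comPzSemiRingType) (Sigma : finType) : Type :=
| EMono (m : monomial K Sigma)
| ESum (Rs : seq nat) (_ : uniq Rs) (p : msol Sigma) (t : msoleval K Sigma).

Fixpoint eval_monomial (K : comPzSemiRingType) (Sigma : finType)
    (w : seq Sigma) (m : monomial K Sigma) (s : assignment w) {struct m} : K :=
  match m with
  | MProd r v p => r ^+ #|[set i : pos w | sat p (upd1 s v i)]|
  | MMul m1 m2 => eval_monomial m1 s * eval_monomial m2 s
  end.

Fixpoint E (K : comPzSemiRingType) (Sigma : finType) (w : seq Sigma)
    (t : msoleval K Sigma) (s : assignment w) {struct t} : K :=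
  match t with
  | EMono m => eval_monomial m s
  | ESum Rs _ p t =>
      \sum_(As : (size Rs).-tuple {set pos w} | sat p (updn s Rs As))
         E t (updn s Rs As)
  end.

Fixpoint monomial_fv (K : comPzSemiRingType) (Sigma : finType)
    (m : monomial K Sigma) : seq (nat + nat) :=
  match m with
  | MProd _ v p => [seq z <- msol_fv p | z != inl v]
  | MMul m1 m2 => monomial_fv m1 ++ monomial_fv m2
  end.

Fixpoint msoleval_fv (K : comPzSemiRingType) (Sigma : finType)
    (t : msoleval K Sigma) : seq (nat + nat) :=
  match t with
  | EMono m => monomial_fv m
  | ESum Rs _ p t =>
      [seq z <- msol_fv p ++ msoleval_fv t | z \notin map inr Rs]
  end.

(* A common raw syntax of which WMSOL, bMSOL and RMSOL are fragments. WMSOL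
   negates atoms only, bMSOL negates arbitrary bMSOL formulas. *)
Inductive formula (K : comPzSemiRingType) (Sigma : finType) : Type :=
| Const (k : K)
| Letter (a : Sigma) (x : nat)
| Le (x y : nat)
| Mem (x X : nat)
| Not (f : formula K Sigma)
| Or (f g : formula K Sigma)
| And (f g : formula K Sigma)
| Ex1 (x : nat) (f : formula K Sigma)
| Ex2 (X : nat) (f : formula K Sigma)
| All1 (x : nat) (f : formula K Sigma)
| All2 (X : nat) (f : formula K Sigma).

(* Negation only matters on formulas with values in {0, 1}; there it is the
   Boolean one, see WE_bmsol below. *)
Fixpoint WE (K : comPzSemiRingType) (Sigma : finType) (w : seq Sigma)
    (f : formula K Sigma) (s : assignment w) {struct f} : K :=
  match f with
  | Const k => k
  | Letter a x => if letter_at a (fo s x) then 1 else 0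
  | Le x y => if (fo s x <= fo s y)%N then 1 else 0
  | Mem x X => if fo s x \in so s X then 1 else 0
  | Not f => if WE f s == 0 then 1 else 0
  | Or f g => WE f s + WE g s
  | And f g => WE f s * WE g s
  | Ex1 x f => \sum_(i : pos w) WE f (upd1 s x i)
  | Ex2 X f => \sum_(A : {set pos w}) WE f (upd2 s X A)
  | All1 x f => \prod_(i : pos w) WE f (upd1 s x i)
  | All2 X f => \prod_(A : {set pos w}) WE f (upd2 s X A)
  end.

Fixpoint formula_fv (K : comPzSemiRingType) (Sigma : finType)
    (f : formula K Sigma) : seq (nat + nat) :=
  match f with
  | Const _ => [::]
  | Letter _ x => [:: inl x]
  | Le x y => [:: inl x; inl y]
  | Mem x X => [:: inl x; inr X]
  | Not f => formula_fv f
  | Or f g | And f g => formula_fv f ++ formula_fv g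
  | Ex1 x f | All1 x f => [seq z <- formula_fv f | z != inl x]
  | Ex2 X f | All2 X f => [seq z <- formula_fv f | z != inr X]
  end.

Definition atomic (K : comPzSemiRingType) (Sigma : finType)
    (f : formula K Sigma) : bool :=
  match f with Letter _ _ | Le _ _ | Mem _ _ => true | _ => false end.

Fixpoint bmsol (K : comPzSemiRingType) (Sigma : finType)
    (f : formula K Sigma) : bool :=
  match f with
  | Const k => (k == 0) || (k == 1)
  | Letter _ _ | Le _ _ | Mem _ _ => true
  | Not f => bmsol f
  | And f g => bmsol f && bmsol g
  | All1 _ f | All2 _ f => bmsol f
  | Or _ _ | Ex1 _ _ | Ex2 _ _ => false
  end.

(* \bigvee_(i in I) (f_i /\ k_i) with I finite and non-empty, under any
   bracketing; the empty disjunction is the bMSOL formula Const 0. *)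
Fixpoint bstep (K : comPzSemiRingType) (Sigma : finType)
    (f : formula K Sigma) : bool :=
  match f with
  | Or f g => bstep f && bstep g
  | And f (Const _) => bmsol f
  | _ => false
  end.

(* bMSOL formulas count as WMSOL and RMSOL formulas, so that they may occur
   below the weighted connectives and universal quantifiers. *)
Fixpoint wmsol (K : comPzSemiRingType) (Sigma : finType)
    (f : formula K Sigma) : bool :=
  bmsol f ||
  match f with
  | Const _ | Letter _ _ | Le _ _ | Mem _ _ => true
  | Not f => atomic f
  | Or f g | And f g => wmsol f && wmsol g
  | Ex1 _ f | Ex2 _ f | All1 _ f | All2 _ f => wmsol f
  end.

Fixpoint rmsol (K : comPzSemiRingType) (Sigma : finType)
    (f : formula K Sigma) : bool :=
  bmsol f ||
  match f with
  | Const _ | Letter _ _ | Le _ _ | Mem _ _ => true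
  | Not f => atomic f
  | Or f g | And f g => rmsol f && rmsol g
  | Ex1 _ f | Ex2 _ f => rmsol f
  | All1 _ f => bstep f
  | All2 _ f => bmsol f
  end.

Lemma bmsol_wmsol (K : comPzSemiRingType) (Sigma : finType)
    (f : formula K Sigma) : bmsol f -> wmsol f.
Proof. by case: f => //= *; apply/orP; left. Qed.

Lemma bstep_wmsol (K : comPzSemiRingType) (Sigma : finType)
    (f : formula K Sigma) : bstep f -> wmsol f.
Proof.
elim: f => //= [f IHf g IHg /andP[/IHf -> /IHg ->] // | f _ g _].
by case: g => //= k /bmsol_wmsol ->; rewrite !orbT.
Qed.

Lemma rmsol_wmsol (K : comPzSemiRingType) (Sigma : finType)
    (f : formula K Sigma) : rmsol f -> wmsol f.
Proof.
elim: f => //=.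
- by move=> f IHf g IHg /andP[/IHf -> /IHg ->].
- by move=> f IHf g IHg /orP[-> // | /andP[/IHf -> /IHg ->]]; rewrite orbT.
- by move=> x f _ /orP[-> // | /bstep_wmsol ->]; rewrite orbT.
- by move=> X f _; rewrite orbb => ->.
Qed.

Fixpoint msol_of (K : comPzSemiRingType) (Sigma : finType)
    (f : formula K Sigma) : msol Sigma :=
  match f with
  | Const k => if k == 0 then MFalse else MNot MFalse
  | Letter a x => MLetter a x
  | Le x y => MLe x y
  | Mem x X => MMem x X
  | Not f => MNot (msol_of f)
  | Or f g => MOr (msol_of f) (msol_of g)
  | And f g => MAnd (msol_of f) (msol_of g)
  | Ex1 x f => MEx1 x (msol_of f)
  | Ex2 X f => MEx2 X (msol_of f)
  | All1 x f => MAll1 x (msol_of f)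
  | All2 X f => MAll2 X (msol_of f)
  end.

Lemma prod_bool (K : comPzSemiRingType) (I : finType) (P : pred I) :
  \prod_(i : I) (if P i then 1 else 0 : K) = if [forall i, P i] then 1 else 0.
Proof.
case: forallP => [h | /forallP]; first by apply: big1 => i _; rewrite h.
rewrite negb_forall => /existsP[i /negbTE nPi].
by rewrite (bigD1 i) //= nPi mul0r.
Qed.

Lemma WE_bmsol (K : comPzSemiRingType) (Sigma : finType) (w : seq Sigma)
    (f : formula K Sigma) (s : assignment w) :
  bmsol f -> WE f s = if sat (msol_of f) s then 1 else 0.
Proof.
have trivK (x y : K) : 1 = 0 :> K -> x = y.
  by move=> e; rewrite -[x]mul1r -[y]mul1r e !mul0r.
elim: f s => //=.
- by move=> k s /orP[] /eqP ->; case: eqP.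
- move=> f IHf s /IHf ->; case: (sat _ s); last by rewrite eqxx.
  by case: eqP => //; apply: trivK.
- move=> f IHf g IHg s /andP[/IHf -> /IHg ->].
  by case: (sat (msol_of f) s) => /=; rewrite ?mul1r ?mul0r.
- by move=> x f IHf s bf; rewrite -prod_bool; apply: eq_bigr => i _; exact: IHf.
- by move=> X f IHf s bf; rewrite -prod_bool; apply: eq_bigr => A _; exact: IHf.
Qed.

(* Main.v *)
(* Every RMSOL formula is equivalent to a sum, over the values of finitely many
   fresh set variables, of a single monomial. Boolean guards are monomials over
   0, since 0 ^ 0 = 1. Two sums are multiplied by making their bound variables
   disjoint. They are added by padding them to the same number of variables and
   letting one more set variable, restricted to the empty set and the universe,
   select the summand. A sum over positions is a sum over singletons. Under a
   universal first-order quantifier, the disjuncts of a step formula that hold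
   at a position determine its weight, so that grouping the positions by these
   turns the product into a monomial. *)
Require Import Defs.
From HB Require Import structures.
From mathcomp Require Import all_boot all_order all_algebra.

Set Implicit Arguments.
Unset Strict Implicit.
Unset Printing Implicit Defensive.

Import GRing.Theory.
Local Open Scope ring_scope.

(** * Dependence on free variables only *)

Section Coincidence.

Variables (K : comPzSemiRingType) (Sigma : finType) (w : seq Sigma).
Implicit Types (s : assignment w) (P Q : pred (nat + nat)).

Definition agree P s s' :=
  (forall x, P (inl x) -> fo s x = fo s' x) /\
  (forall X, P (inr X) -> so s X = so s' X).

Lemma agree_sub P Q s s' :
  (forall z, P z -> Q z) -> agree Q s s' -> agree P s s'.
Proof. by move=> PQ [h1 h2]; split=> z /PQ; [apply: h1 | apply: h2]. Qed.

Lemma agree_upd1 P Q s s' x i :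
  (forall z, Q z -> z != inl x -> P z) ->
  agree P s s' -> agree Q (upd1 s x i) (upd1 s' x i).
Proof.
move=> QP [h1 h2]; split=> [y | Y] /QP /= hy.
  by case: eqP => // /eqP yx; apply/h1/hy.
exact/h2/hy.
Qed.

Lemma agree_upd2 P Q s s' X A :
  (forall z, Q z -> z != inr X -> P z) ->
  agree P s s' -> agree Q (upd2 s X A) (upd2 s' X A).
Proof.
move=> QP [h1 h2]; split=> [y | Y] /QP /= hy; first exact/h1/hy.
by case: eqP => // /eqP yx; apply/h2/hy.
Qed.

Lemma sat_agree (p : msol Sigma) s s' :
  agree (mem (msol_fv p)) s s' -> sat p s = sat p s'.
Proof.
elim: p s s' => //=.
- by move=> a x s s' [h _]; rewrite h ?inE ?eqxx.
- by move=> x y s s' [h _]; rewrite !h ?inE ?eqxx ?orbT.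
- by move=> x y s s' [h _]; rewrite !h ?inE ?eqxx ?orbT.
- by move=> x X s s' [h1 h2]; rewrite h1 ?h2 ?inE ?eqxx ?orbT.
- by move=> p IHp s s' /IHp ->.
- move=> p IHp q IHq s s' h; rewrite (IHp s s') ?(IHq s s') //.
    by apply: agree_sub h => z /=; rewrite mem_cat orbC => ->.
  by apply: agree_sub h => z /=; rewrite mem_cat => ->.
- move=> p IHp q IHq s s' h; rewrite (IHp s s') ?(IHq s s') //.
    by apply: agree_sub h => z /=; rewrite mem_cat orbC => ->.
  by apply: agree_sub h => z /=; rewrite mem_cat => ->.
- move=> x p IHp s s' h; apply: eq_existsb => i; apply: IHp.
  by apply: agree_upd1 h => z /=; rewrite mem_filter => -> ->.
- move=> X p IHp s s' h; apply: eq_existsb => A; apply: IHp.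
  by apply: agree_upd2 h => z /=; rewrite mem_filter => -> ->.
- move=> x p IHp s s' h; apply: eq_forallb => i; apply: IHp.
  by apply: agree_upd1 h => z /=; rewrite mem_filter => -> ->.
- move=> X p IHp s s' h; apply: eq_forallb => A; apply: IHp.
  by apply: agree_upd2 h => z /=; rewrite mem_filter => -> ->.
Qed.

Lemma eval_monomial_agree (m : monomial K Sigma) s s' :
  agree (mem (monomial_fv m)) s s' -> eval_monomial m s = eval_monomial m s'.
Proof.
elim: m s s' => /= [r v p | m1 IH1 m2 IH2] s s' h; last first.
  rewrite (IH1 s s') ?(IH2 s s') //.
    by apply: agree_sub h => z /=; rewrite mem_cat orbC => ->.
  by apply: agree_sub h => z /=; rewrite mem_cat => ->.
congr (_ ^+ _); apply: eq_card => i; rewrite !inE; apply: sat_agree.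
by apply: agree_upd1 h => z /=; rewrite mem_filter => -> ->.
Qed.

(** * Iterated sums over blocks of set variables *)

(** Bound variables have consecutive indices, so that freshness and disjointness become
    inequalities. *)
Fixpoint sum_sets N k (G : assignment w -> K) s {struct k} : K :=
  if k is k'.+1
  then \sum_(A : {set pos w}) sum_sets N.+1 k' G (upd2 s N A)
  else G s.

(** A simulation argument: [R i] relates the assignments reached just before variable [i] is bound.
    A relation kept by parallel updates only has to match the summands at the end. *)
Lemma sum_sets_rel (R : nat -> assignment w -> assignment w -> Prop) N k
    (G G' : assignment w -> K) s s' :
  (forall i t t' A, (N <= i)%N -> R i t t' ->
     R i.+1 (upd2 t i A) (upd2 t' i A)) ->
  (forall t t', R (N + k)%N t t' -> G t = G' t') ->
  R N s s' -> sum_sets N k G s = sum_sets N k G' s'.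
Proof.
elim: k N s s' => [|k IHk] N s s' hR hG h /=; first by apply: hG; rewrite addn0.
apply: eq_bigr => A _; apply: IHk => [i t t' B Ni|t t'|].
- by apply: hR; exact: ltnW.
- by rewrite addSnnS; apply: hG.
- exact: hR.
Qed.

Lemma eq_sum_sets N k (G G' : assignment w -> K) s :
  (forall t, G t = G' t) -> sum_sets N k G s = sum_sets N k G' s.
Proof.
by move=> eG; apply: (sum_sets_rel (R := fun=> eq)) => // [i t t' A _ ->|t t' ->].
Qed.

Lemma sum_sets0 N k s : sum_sets N k (fun=> 0) s = 0.
Proof. by elim: k N s => //= k IHk N s; apply: big1 => A _. Qed.

Lemma sum_sets_cat N k1 k2 (G : assignment w -> K) s :
  sum_sets N (k1 + k2) G s = sum_sets N k1 (sum_sets (N + k1) k2 G) s.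
Proof.
elim: k1 N s => [|k1 IHk] N s /=; first by rewrite addn0.
by apply: eq_bigr => A _; rewrite IHk addSnnS.
Qed.

(** Distributivity, with freshness of the block for [H] put semantically, as invariance under
    updates from [N] on. *)
Lemma sum_sets_mulr N k (G H : assignment w -> K) s :
  (forall t i A, (N <= i)%N -> H (upd2 t i A) = H t) ->
  sum_sets N k (fun t => G t * H t) s = sum_sets N k G s * H s.
Proof.
elim: k N s => //= k IHk N s hH; rewrite mulr_suml.
apply: eq_bigr => A _; rewrite IHk ?hH // => t i B Ni.
by apply: hH; exact: ltnW.
Qed.

Lemma sum_sets_mull N k (G H : assignment w -> K) s :
  (forall t i A, (N <= i)%N -> H (upd2 t i A) = H t) ->
  sum_sets N k (fun t => H t * G t) s = H s * sum_sets N k G s.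
Proof.
by move=> hH; rewrite mulrC -sum_sets_mulr //; apply: eq_sum_sets => t; rewrite mulrC.
Qed.

Lemma expr0_card (T : finType) (A : {set T}) :
  (0 : K) ^+ #|A| = if A == set0 then 1 else 0.
Proof. by rewrite expr0n cards_eq0; case: (A == set0). Qed.

Lemma sum_singletons (T : finType) (h : {set T} -> K) :
  \sum_(A : {set T} | #|A| == 1%N) h A = \sum_(i : T) h [set i].
Proof.
rewrite -(big_imset h (A := predT) (h := fun i => [set i])) /=; last first.
  by move=> i j _ _ /set1_inj.
apply: eq_bigl => A; apply/cards1P/imsetP => [[i ->]|[i _ ->]]; last by exists i.
by exists i.
Qed.

End Coincidence.

(** * Scopes and the normal form *)

Definition scope (V : seq (nat + nat)) N k : pred (nat + nat) :=
  fun z => (z \in V) || (if z is inr Z then (N <= Z < N + k)%N else false).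

(** Keeps the block starting at [N] disjoint from [V]. *)
Definition bounded (V : seq (nat + nat)) N :=
  forall z, z \in V -> match z with inl x => (x < N)%N | inr X => (X < N)%N end.

Lemma bounded_exists V : exists N, bounded V N.
Proof.
elim: V => [|z V [N bV]]; first by exists 0%N => z.
exists (maxn N (match z with inl x => x.+1 | inr X => X.+1 end)) => y.
rewrite inE => /orP[/eqP -> | /bV]; first by case: z => x; rewrite leq_max leqnn orbT.
by case: y => x h; rewrite leq_max h.
Qed.

Lemma bounded_leq V N N' : (N <= N')%N -> bounded V N -> bounded V N'.
Proof. by move=> le bV [x|x] /bV h; apply: leq_trans h le. Qed.

Section Definable.

Variables (K : comPzSemiRingType) (Sigma : finType).

(* Asking for all large enough [N] lets the bound set variables [N], ...,
   [N + k - 1] avoid any given finite set of variables. *)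
Definition definable (V : seq (nat + nat))
    (F : forall w : seq Sigma, assignment w -> K) : Prop :=
  exists N0, forall N, (N0 <= N)%N -> exists k (m : monomial K Sigma),
    (forall z, z \in monomial_fv m -> scope V N k z) /\
    forall w (s : assignment w), F w s = sum_sets N k (eval_monomial m) s.

Lemma definable_sub V V' F F' :
  {subset V <= V'} -> (forall w (s : assignment w), F w s = F' w s) ->
  definable V F -> definable V' F'.
Proof.
move=> sV eF [N0 h]; exists N0 => N /h [k [m [fvm em]]]; exists k, m.
split=> [z /fvm /orP[/sV zV | zN] | w s]; rewrite -?eF //; apply/orP; by [left|right].
Qed.

Lemma definable_monomial (m : monomial K Sigma) V :
  {subset monomial_fv m <= V} ->
  definable V (fun w s => eval_monomial m s).
Proof.
move=> sV; exists 0%N => N _; exists 0%N, m; split=> // z /sV zV.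
by rewrite /scope zV.
Qed.

Lemma definable_const (k : K) : definable [::] (fun _ _ => k).
Proof.
(* Only the least position is below every position, so the exponent is one. *)
apply: definable_sub (definable_monomial (m := MProd k 0 (MAll1 1 (MLe 0 1)))
  (V := [::]) _) => // w s /=.
rewrite (_ : [set i | _] = [set ord0]) ?cards1 ?expr1 //.
apply/setP=> i; rewrite !inE; apply/forallP/eqP => /= [/(_ ord0)|-> //].
by rewrite leqn0 => /eqP i0; apply: val_inj.
Qed.

(* A product over no position is [1], and the universe is never empty, so that
   monomials over [0] express Boolean guards. *)
Lemma eval_guard (c : msol Sigma) v w (s : assignment w) :
  inl v \notin msol_fv c ->
  eval_monomial (MProd (0 : K) v (MNot c)) s = if sat c s then 1 else 0.
Proof.
move=> vc; rewrite /eval_monomial expr0_card.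
have e i : sat (MNot c) (upd1 s v i) = ~~ sat c s.
  congr (~~ _); apply: sat_agree; split=> //= x xc.
  by case: eqP => // xv; rewrite -xv xc in vc.
case: (boolP (sat c s)) => cs.
  by rewrite ifT //; apply/eqP/setP=> i; rewrite inE e cs inE.
by rewrite ifF //; apply/eqP => /setP /(_ ord0); rewrite inE e cs inE.
Qed.

Lemma definable_sat (p : msol Sigma) :
  definable (msol_fv p) (fun w s => if sat p s then 1 else 0).
Proof.
(* The counting variable [v] must not be free in [p], lest it capture. *)
have [v bv] := bounded_exists (msol_fv p).
have vp : inl v \notin msol_fv p by apply/negP => /bv; rewrite ltnn.
apply: definable_sub (definable_monomial (m := MProd 0 v (MNot p)) (V := msol_fv p) _).
- by [].
- by move=> w s; apply: eval_guard.
- by move=> z /=; rewrite mem_filter => /andP[].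
Qed.

Lemma sum_sets_agree V N k (m : monomial K Sigma) w (s s' : assignment w) :
  (forall z, z \in monomial_fv m -> scope V N k z) -> agree (mem V) s s' ->
  sum_sets N k (eval_monomial m) s = sum_sets N k (eval_monomial m) s'.
Proof.
move=> fvm h.
(* Before [i] is bound, the assignments agree on [V] and on the part of the block bound so far. *)
apply: (sum_sets_rel (R := fun i => agree (scope V N (i - N)))).
- move=> i t t' A Ni; apply: agree_upd2 => -[x|X] //; rewrite /scope.
  move=> /orP[-> //|/andP[NX]]; rewrite subSn // addnS ltnS subnKC // => Xi Xn.
  by rewrite NX ltn_neqAle Xi andbT; apply/orP; right; apply: contraNN Xn => /eqP ->.
- move=> t t' ht; apply: eval_monomial_agree; apply: agree_sub ht => z /fvm.
  by rewrite addKn.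
- rewrite subnn; apply: agree_sub h => -[x|X] /orP[] //.
  by rewrite addn0 => /andP[a b]; move: (leq_ltn_trans a b); rewrite ltnn.
Qed.

Lemma eval_monomial_fresh (m : monomial K Sigma) V N k w (s : assignment w) i A :
  (forall z, z \in monomial_fv m -> scope V N k z) -> bounded V N ->
  (N + k <= i)%N -> eval_monomial m (upd2 s i A) = eval_monomial m s.
Proof.
move=> fvm bV Ni; apply: eval_monomial_agree; split=> //= X /fvm /orP h.
case: eqP => // Xi; rewrite {}Xi in h; case: h => [/bV h | /andP[_ h]].
  by move: (leq_trans h (leq_trans (leq_addr k N) Ni)); rewrite ltnn.
by move: (leq_trans h Ni); rewrite ltnn.
Qed.

(** * Closure under products and sums *)

(** The second block starts where the first ends. Distributivity then applies twice: [G] depends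
    only on [V], which lies below [N], and the set variables of the first monomial lie below
    [N + k1]. *)
Lemma definable_mul V F G :
  definable V F -> definable V G -> definable V (fun w s => F w s * G w s).
Proof.
move=> [N1 h1] [N2 h2]; have [N3 bV] := bounded_exists V.
exists (maxn N3 (maxn N1 N2)) => N.
rewrite !geq_max => /and3P[/bounded_leq/(_ bV) bN le1 le2].
have [k1 [m1 [fv1 e1]]] := h1 N le1.
have [k2 [m2 [fv2 e2]]] := h2 (N + k1)%N (leq_trans le2 (leq_addr _ _)).
exists (k1 + k2)%N, (MMul m1 m2); split=> [z | w s].
  rewrite mem_cat => /orP[/fv1 | /fv2] /orP[zV | h]; apply/orP; first [by left | right].
    case: z h => // Z /andP[-> /leq_trans]; apply; by rewrite addnA leq_addr.
  case: z h => // Z /andP[a]; rewrite addnA => ->; rewrite andbT.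
  exact: leq_trans (leq_addr _ _) a.
rewrite sum_sets_cat e1 -sum_sets_mulr /=; last first.
  move=> t i A Ni; rewrite !e2; apply: sum_sets_agree fv2 _; split=> //= X /bN.
  by case: eqP => // -> h; move: (leq_trans h Ni); rewrite ltnn.
apply: eq_sum_sets => t; rewrite e2 -sum_sets_mull // => {}t i A Ni.
exact: eval_monomial_fresh fv1 bN Ni.
Qed.

(** Each extra set variable gets a factor [0 ^ n], with [n] the size of its value. Only the empty
    set contributes, and it contributes a factor 1. *)
Lemma sum_sets_pad V N k (m : monomial K Sigma) k' : (k <= k')%N -> bounded V N ->
  (forall z, z \in monomial_fv m -> scope V N k z) ->
  exists m', (forall z, z \in monomial_fv m' -> scope V N k' z) /\
    forall w (s : assignment w),
      sum_sets N k' (eval_monomial m') s = sum_sets N k (eval_monomial m) s.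
Proof.
move=> + bV fvm; elim: k' => [|k' IHk].
  by rewrite leqn0 => /eqP <-; exists m.
rewrite leq_eqVlt ltnS => /orP[/eqP <-|/IHk [m' [fvm' em']]]; first by exists m.
exists (MMul m' (MProd 0 0 (MMem 0 (N + k')))); split=> [z | w s].
  rewrite /= mem_cat => /orP[/fvm' /orP[zV | h]|].
  - by rewrite /scope zV.
  - rewrite /scope; case: z h => // Z /andP[-> h].
    by rewrite addnS ltnS (ltnW h) orbT.
  - by rewrite inE => /eqP ->; rewrite /scope addnS ltnS leqnn leq_addr orbT.
rewrite -em' -addn1 sum_sets_cat; apply: eq_sum_sets => t /=.
rewrite (bigD1 set0) //= big1 ?addr0 => [|A A0]; rewrite expr0_card.
  rewrite ifT ?mulr1; last by apply/eqP/setP=> i; rewrite !inE /= eqxx inE.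
  exact: eval_monomial_fresh fvm' bV _.
rewrite (_ : [set i | _] = A) ?(negbTE A0) ?mulr0 //.
by apply/setP=> i; rewrite !inE eqxx.
Qed.

(** A closed gate yields 1 rather than 0, so that in a product of gated monomials only the open ones
    count. *)
Fixpoint gate (c : msol Sigma) (m : monomial K Sigma) : monomial K Sigma :=
  match m with
  | MProd r v p => MProd r v (MAnd p c)
  | MMul m1 m2 => MMul (gate c m1) (gate c m2)
  end.

Lemma gate_fv c m z : z \in monomial_fv (gate c m) ->
  (z \in monomial_fv m) || (z \in msol_fv c).
Proof.
elim: m => [r v p | m1 IH1 m2 IH2] /=.
  by rewrite !mem_filter mem_cat => /andP[-> ].
by rewrite !mem_cat => /orP[/IH1|/IH2] /orP[]->; rewrite ?orbT.
Qed.

(** If [c] fails, every counted set is empty and every exponent is zero. Since [c] has no free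
    first-order variable, the binders in [m] cannot capture anything. *)
Lemma eval_gate c m w (s : assignment w) :
  (forall x, inl x \notin msol_fv c) ->
  eval_monomial (gate c m) s = if sat c s then eval_monomial m s else 1.
Proof.
move=> hc; elim: m => [r v p | m1 IH1 m2 IH2] /=; last first.
  by rewrite IH1 IH2; case: (sat c s); rewrite ?mulr1.
have e i : sat c (upd1 s v i) = sat c s.
  by apply: sat_agree; split=> //= x; rewrite (negbTE (hc x)).
case: ifP => cs; first by congr (_ ^+ _); apply: eq_card => i; rewrite !inE e cs andbT.
by rewrite (_ : [set i | _] = set0) ?cards0 //; apply/setP=> i; rewrite !inE e cs andbF.
Qed.

Definition is_empty Z : msol Sigma := MAll1 0 (MNot (MMem 0 Z)).
Definition is_full Z : msol Sigma := MAll1 0 (MMem 0 Z).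

Lemma sat_is_empty Z w (s : assignment w) : sat (is_empty Z) s = (so s Z == set0).
Proof.
apply/forallP/eqP => /= [h|-> i]; last by rewrite inE.
by apply/setP=> i; rewrite inE; apply/negbTE/h.
Qed.

Lemma sat_is_full Z w (s : assignment w) : sat (is_full Z) s = (so s Z == setT).
Proof.
apply/forallP/eqP => /= [h|-> i]; last by rewrite inE.
by apply/setP=> i; rewrite inE; apply/h.
Qed.

(** Position 0 exists even for the empty word, so the two selector values always differ. *)
Lemma setT_neq0 (w : seq Sigma) : ([set: pos w] == set0) = false.
Proof. by apply/negbTE/set0Pn; exists ord0. Qed.

(* The extra set variable [N] selects the summand: its values other than the
   empty set and the universe contribute [0]. *)
Lemma definable_add V F G :
  definable V F -> definable V G -> definable V (fun w s => F w s + G w s).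
Proof.
move=> [N1 h1] [N2 h2]; have [N3 bV] := bounded_exists V.
exists (maxn N3 (maxn N1 N2)) => N.
rewrite !geq_max => /and3P[/bounded_leq/(_ bV) bN le1 le2].
have bN1 := bounded_leq (leqnSn N) bN.
(* Both summands share the block from [N.+1] on, which leaves [N] free for the selector. *)
have [k1 [m1 [fv1 e1]]] := h1 N.+1 (leqW le1).
have [k2 [m2 [fv2 e2]]] := h2 N.+1 (leqW le2).
have [m1' [fv1' e1']] := sum_sets_pad (leq_maxl k1 k2) bN1 fv1.
have [m2' [fv2' e2']] := sum_sets_pad (leq_maxr k1 k2) bN1 fv2.
set k := maxn k1 k2 in fv1' fv2' e1' e2'.
pose sel := MProd (0 : K) 0 (MNot (MOr (is_empty N) (is_full N))).
exists k.+1, (MMul (MMul (gate (is_empty N) m1') (gate (is_full N) m2')) sel).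
split=> [z | w s].
  have hN : scope V N k.+1 (inr N).
    by rewrite /scope leqnn addnS ltnS leq_addr orbT.
  have sc : scope V N.+1 k z -> scope V N k.+1 z.
    case: z => // Z /orP[zV|/andP[a b]]; apply/orP; first by left.
    by right; rewrite (ltnW a) -addSnnS.
  rewrite /= !mem_cat => /orP[/orP[/gate_fv|/gate_fv]|]; rewrite ?inE.
  - by move=> /orP[/fv1'/sc // | /eqP ->].
  - by move=> /orP[/fv2'/sc // | /eqP ->].
  - by rewrite orbb => /eqP ->.
have hsel (t : assignment w) : eval_monomial sel t =
    if (so t N == set0) || (so t N == setT) then 1 else 0.
  by rewrite eval_guard //= -sat_is_empty -sat_is_full.
have step A : sum_sets N.+1 k (eval_monomial (MMul (MMul (gate (is_empty N) m1')
     (gate (is_full N) m2')) sel)) (upd2 s N A) =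
    if A == set0 then sum_sets N.+1 k (eval_monomial m1') s else
    if A == setT then sum_sets N.+1 k (eval_monomial m2') s else 0.
  have fresh (m : monomial K Sigma) :
      (forall z, z \in monomial_fv m -> scope V N.+1 k z) ->
      sum_sets N.+1 k (eval_monomial m) (upd2 s N A) =
      sum_sets N.+1 k (eval_monomial m) s.
    move=> fvm; apply: (sum_sets_agree fvm); split=> //= X /bN.
    by case: eqP => // ->; rewrite ltnn.
  have gE t : so t N = A -> eval_monomial (MMul (MMul (gate (is_empty N) m1')
     (gate (is_full N) m2')) sel) t = if A == set0 then eval_monomial m1' t else
       if A == setT then eval_monomial m2' t else 0.
    move=> tA; cbn [eval_monomial].
    rewrite hsel !eval_gate // sat_is_empty sat_is_full tA.
    case: eqP => [->|_]; first by rewrite eq_sym setT_neq0 !mulr1.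
    by case: eqP => _ /=; rewrite ?mulr1 ?mul1r ?mulr0.
  (* All later bindings are above [N], so the selector still has value [A] when the gates are
     evaluated. *)
  rewrite (sum_sets_rel (R := fun _ t t' => t = t' /\ so t N = A)
    (G' := fun t => if A == set0 then eval_monomial m1' t else
       if A == setT then eval_monomial m2' t else 0) (s' := upd2 s N A)).
  - case: eqP => [_|_]; first exact: fresh.
    case: eqP => [_|_]; first exact: fresh.
    exact: sum_sets0.
  - move=> i t t' B Ni [-> tA]; split=> //=; case: eqP => // Ni'.
    by rewrite Ni' ltnn in Ni.
  - by move=> t t' [<- tA]; apply: gE.
  - by rewrite /= eqxx.
rewrite /= (eq_bigr _ (fun A _ => step A)) (bigD1 set0) //= eqxx.
rewrite (bigD1 setT) ?setT_neq0 //= eqxx big1 ?addr0.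
  by rewrite e1 e2 e1' e2'.
by move=> A /andP[/negbTE -> /negbTE ->].
Qed.

(** * Renaming, and sums over sets and positions *)

(** The transformation receives the binder [v] because renaming a first-order variable must notice
    when [v] shadows it. *)
Fixpoint map_monomial (T : nat -> msol Sigma -> msol Sigma)
    (m : monomial K Sigma) : monomial K Sigma :=
  match m with
  | MProd r v p => MProd r v (T v p)
  | MMul m1 m2 => MMul (map_monomial T m1) (map_monomial T m2)
  end.

Lemma map_monomial_fv T (P Q : pred (nat + nat)) m :
  (forall v p, (forall z, z \in msol_fv p -> z != inl v -> P z) ->
     forall z, z \in msol_fv (T v p) -> z != inl v -> Q z) ->
  (forall z, z \in monomial_fv m -> P z) ->
  forall z, z \in monomial_fv (map_monomial T m) -> Q z.
Proof.
move=> hT; elim: m => [r v p | m1 IH1 m2 IH2] /= fvm z; last first.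
  by rewrite mem_cat => /orP[]; [apply: IH1|apply: IH2] => y ym;
     apply: fvm; rewrite mem_cat ym ?orbT.
rewrite mem_filter => /andP[zv zT]; apply: hT zT zv => y yp yv; apply: fvm.
by rewrite mem_filter yv.
Qed.

Lemma eval_map_monomial T (P : pred (nat + nat)) m w (s s' : assignment w) :
  (forall v p i, (forall z, z \in msol_fv p -> z != inl v -> P z) ->
     sat p (upd1 s v i) = sat (T v p) (upd1 s' v i)) ->
  (forall z, z \in monomial_fv m -> P z) ->
  eval_monomial m s = eval_monomial (map_monomial T m) s'.
Proof.
move=> hT; elim: m => [r v p | m1 IH1 m2 IH2] /= fvm; last first.
  by rewrite IH1 ?IH2 // => z zm; apply: fvm; rewrite mem_cat zm ?orbT.
congr (_ ^+ _); apply: eq_card => i; rewrite !inE; apply: hT => z zp zv.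
by apply: fvm; rewrite mem_filter zv.
Qed.

Definition set_eq X Z : msol Sigma :=
  MAll1 0 (MOr (MAnd (MMem 0 X) (MMem 0 Z))
               (MAnd (MNot (MMem 0 X)) (MNot (MMem 0 Z)))).

Lemma sat_set_eq X Z w (s : assignment w) : sat (set_eq X Z) s = (so s X == so s Z).
Proof.
apply/forallP/eqP => /= [h|-> i]; last by case: (_ \in _).
by apply/setP=> i; have := h i; do 2 case: (i \in _).
Qed.

(* Capture-avoiding renaming of [X] into [Z]. *)
Definition rename2 X Z (_ : nat) p : msol Sigma := MEx2 X (MAnd (set_eq X Z) p).

Lemma scope_bind V N k y z : z != y ->
  scope V N.+1 k z -> scope [seq u <- V | u != y] N k.+1 z.
Proof.
rewrite /scope mem_filter => -> /orP[-> // | ]; case: z => // Z /andP[a b].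
by rewrite (ltnW a) -addSnnS b orbT.
Qed.

(** The summation variable [X] is renamed to [N], which heads the block obtained at [N.+1]. Taking
    [N] above [X] and above [V] makes it fresh. *)
Lemma definable_sum2 V F X : definable V F ->
  definable [seq z <- V | z != inr X]
    (fun w s => \sum_(A : {set pos w}) F w (upd2 s X A)).
Proof.
move=> [N1 h1]; have [N2 bV] := bounded_exists V.
exists (maxn X.+1 (maxn N1 N2)) => N.
rewrite !geq_max => /and3P[XN le1 /bounded_leq/(_ bV) bN].
have [k [m [fvm em]]] := h1 N.+1 (leqW le1).
have fvN : ~~ scope V N.+1 k (inr N).
  by rewrite /scope ltnn orbF; apply/negP => /bN; rewrite ltnn.
exists k.+1, (map_monomial (rename2 X N) m); split=> [z | w s].
  apply: (map_monomial_fv (P := scope V N.+1 k)) => // v p fvp {}z.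
  have -> : msol_fv (rename2 X N v p) =
    [seq y <- [:: inr X; inr N; inr X; inr N] ++ msol_fv p | y != inr X] by [].
  rewrite mem_filter mem_cat !inE => /andP[zX]; rewrite (negbTE zX) /= orbb.
  move=> /orP[/eqP ->|zp zv]; first by rewrite /scope leqnn addnS ltnS leq_addr orbT.
  by apply: scope_bind zX _; apply: fvp.
apply: eq_bigr => A _; rewrite em.
(* The left side stores [A] in [X], the right side in [N]; these two variables are exempt from
   agreement. *)
apply: (sum_sets_rel (R := fun _ (t t' : assignment w) =>
  [/\ forall x, fo t x = fo t' x,
      forall Y, Y != X -> Y != N -> so t Y = so t' Y & so t X = so t' N])).
- move=> i t t' B Ni [h2 h3 h4]; split=> [//|Y YX YN|] /=.
    by case: eqP => // _; apply: h3.
  by rewrite h4 !ltn_eqF // (leq_trans _ Ni) // ltnS ltnW.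
- move=> t t' [h2 h3 h4]; apply: eval_map_monomial fvm => v p i fvp.
  (* As [N] is not free in [p], copying its value into [X] restores agreement on the free variables
     of [p]. *)
  have hp B : B = so t' N -> sat p (upd1 t v i) = sat p (upd2 (upd1 t' v i) X B).
    move=> ->; apply: sat_agree; split=> [x|Y] /=; first by rewrite h2.
    move=> /fvp /(_ isT) hY; case: eqP => [->//|/eqP YX]; apply: h3 => //.
    by apply: contraTneq hY => ->.
  rewrite /rename2; cbn [sat]; apply/idP/existsP => [pt | [B]].
    exists (so t' N); rewrite -hp // pt sat_set_eq /= eqxx.
    by case: (N =P X) => //= [_|_]; rewrite eqxx.
  rewrite sat_set_eq /= eqxx; case: (N =P X) => [e|_].
    by rewrite e ltnn in XN.
  by move=> /andP[/eqP BN]; rewrite -hp.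
- split=> //= [Y /negbTE -> /negbTE -> //|]; by rewrite !eqxx.
Qed.

Definition is_singleton Z : msol Sigma :=
  MEx1 0 (MAnd (MMem 0 Z) (MAll1 1 (MOr (MNot (MMem 1 Z)) (MEq 0 1)))).

Lemma sat_is_singleton Z w (s : assignment w) :
  sat (is_singleton Z) s = (#|so s Z| == 1%N).
Proof.
apply/existsP/cards1P => /= [[i /andP[iZ /forallP h]] | [i sZ]].
  exists i; apply/setP=> j; rewrite inE; apply/idP/eqP => [jZ|-> //].
  by have := h j; rewrite jZ => /eqP.
by exists i; rewrite sZ inE eqxx; apply/forallP=> j; rewrite inE eq_sym orNb.
Qed.

(** If [v] is [x], the monomial itself binds [x] and nothing is to be renamed. Otherwise the
    quantifier recovers [x] from [Z], which will be a singleton. *)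
Definition rename1 x Z v p : msol Sigma :=
  if v == x then p else MEx1 x (MAnd (MMem x Z) p).

Lemma definable_sum1 V F x : definable V F ->
  definable [seq z <- V | z != inl x]
    (fun w s => \sum_(i : pos w) F w (upd1 s x i)).
Proof.
move=> [N1 h1]; have [N2 bV] := bounded_exists V.
exists (maxn N1 N2) => N; rewrite !geq_max => /andP[le1 /bounded_leq/(_ bV) bN].
have [k [m [fvm em]]] := h1 N.+1 (leqW le1).
have fvN : ~~ scope V N.+1 k (inr N).
  by rewrite /scope ltnn orbF; apply/negP => /bN; rewrite ltnn.
have scN V' : scope V' N k.+1 (inr N).
  by rewrite /scope leqnn addnS ltnS leq_addr orbT.
pose guard := MProd (0 : K) 0 (MNot (is_singleton N)).
exists k.+1, (MMul (map_monomial (rename1 x N) m) guard).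
split=> [z | w s].
  rewrite mem_cat => /orP[|]; last by rewrite /= !inE orbb => /eqP ->.
  apply: (map_monomial_fv (P := scope V N.+1 k)) => // v p fvp {}z.
  rewrite /rename1; case: (v =P x) => [vx zp zv|_].
    by apply: scope_bind; [rewrite -vx | apply: fvp].
  have -> : msol_fv (MEx1 x (MAnd (MMem x N) p)) =
    [seq y <- [:: inl x; inr N] ++ msol_fv p | y != inl x] by [].
  rewrite mem_filter mem_cat !inE => /andP[zx]; rewrite (negbTE zx) /=.
  by move=> /orP[/eqP -> // | zp zv]; apply: scope_bind zx _; apply: fvp.
(* First the sum over singletons without the guard; the guard is brought in afterwards. *)
transitivity (\sum_(A : {set pos w} | #|A| == 1%N) sum_sets N.+1 k
   (eval_monomial (map_monomial (rename1 x N) m)) (upd2 s N A)).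
  rewrite sum_singletons; apply: eq_bigr => i _; rewrite em.
  (* The position stored in [x] on the left is the singleton stored in [N] on the right. *)
  apply: (sum_sets_rel (R := fun _ (t t' : assignment w) =>
    [/\ forall y, y != x -> fo t y = fo t' y,
        forall Y, Y != N -> so t Y = so t' Y & so t' N = [set fo t x]])).
  - move=> j t t' B Nj [h2 h3 h4]; split=> [//|Y YN|] /=.
      by case: eqP => // _; apply: h3.
    by rewrite h4 ltn_eqF.
  - move=> t t' [h2 h3 h4]; apply: eval_map_monomial fvm => v p j fvp.
    have hso Y : inr Y \in msol_fv p -> so t Y = so t' Y.
      by move=> /fvp /(_ isT) hY; apply: h3; apply: contraTneq hY => ->.
    rewrite /rename1; case: (v =P x) => [vx|/eqP vx].
      apply: sat_agree; split=> [y|Y] /=; last exact: hso.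
      by rewrite vx; case: eqP => // /eqP yx _; apply: h2.
    have hp : sat p (upd1 t v j) = sat p (upd1 (upd1 t' v j) x (fo t x)).
      apply: sat_agree; split=> [y|Y] /=; last exact: hso.
      case: (y =P x) => [->|/eqP yx]; last by case: eqP => // _ _; apply: h2.
      by rewrite eq_sym (negbTE vx).
    rewrite hp /=; apply/idP/existsP => [pt | [l]].
      by exists (fo t x); rewrite eqxx h4 inE eqxx.
    by rewrite eqxx h4 inE => /andP[/eqP ->].
  - split=> /= [y /negbTE -> // | Y /negbTE -> // |]; by rewrite !eqxx.
rewrite /= big_mkcond; apply: eq_bigr => A _.
have hg (t : assignment w) :
    eval_monomial guard t = if #|so t N| == 1%N then 1 else 0.
  by rewrite eval_guard // sat_is_singleton.
transitivity (sum_sets N.+1 k (fun t =>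
  eval_monomial (map_monomial (rename1 x N) m) t * eval_monomial guard t)
  (upd2 s N A)); last by [].
(* The guard depends only on [N], so it leaves the inner sums. *)
rewrite sum_sets_mulr => [|t i B Ni]; last by rewrite !hg /= (ltn_eqF Ni).
by rewrite hg /= eqxx; case: ifP => _; rewrite ?mulr1 ?mulr0.
Qed.

(** * Universal quantification over step formulas, and the induction *)

(* Splits on the truth value of each formula in turn, [g] collecting the
   choices made and [k0] the weights of the formulas taken to be true. *)
Lemma step_monomial x (L : seq (msol Sigma * K)) g k0 :
  exists m : monomial K Sigma,
    {subset monomial_fv m <=
       [seq z <- msol_fv g ++ flatten [seq msol_fv e.1 | e <- L] | z != inl x]} /\
    forall w (s : assignment w),
      \prod_(i : pos w | sat g (upd1 s x i))
         (k0 + \sum_(e <- L) if sat e.1 (upd1 s x i) then e.2 else 0) =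
      eval_monomial m s.
Proof.
elim: L g k0 => [|[p k] L IHL] g k0.
  (* All splits are made: each remaining position has weight [k0]. *)
  exists (MProd k0 x g); rewrite /= cats0; split=> // w s.
  rewrite (eq_bigr (fun=> k0)) => [|i _]; last by rewrite big_nil addr0.
  by rewrite prodr_const; congr (_ ^+ _); apply: eq_card => i; rewrite inE.
have [m1 [fv1 e1]] := IHL (MAnd g p) (k0 + k).
have [m2 [fv2 e2]] := IHL (MAnd g (MNot p)) k0.
exists (MMul m1 m2); split=> [z|w s].
  by rewrite /= mem_cat => /orP[/fv1|/fv2]; rewrite /= catA.
rewrite /= -e1 -e2 (bigID (fun i => sat p (upd1 s x i))) /=.
congr (_ * _); apply: eq_bigr => i /andP[_ pi]; rewrite big_cons /=.
  by rewrite pi addrA.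
by rewrite (negbTE pi) add0r.
Qed.

Lemma msol_fv_of (f : formula K Sigma) : msol_fv (msol_of f) = formula_fv f.
Proof.
elim: f => //= [k|f -> g -> //|f -> g -> //|x f -> //|X f -> //|x f -> //|X f -> //].
by case: eqP.
Qed.

Lemma bstep_list (f : formula K Sigma) : bstep f ->
  exists L : seq (msol Sigma * K),
    {subset flatten [seq msol_fv e.1 | e <- L] <= formula_fv f} /\
    forall w (s : assignment w), WE f s = \sum_(e <- L) if sat e.1 s then e.2 else 0.
Proof.
elim: f => //= [f IHf g IHg /andP[/IHf [L1 [fv1 e1]] /IHg [L2 [fv2 e2]]] | f _ g _].
  exists (L1 ++ L2); split=> [z|w s]; last by rewrite big_cat e1 e2.
  by rewrite map_cat flatten_cat !mem_cat => /orP[/fv1|/fv2] ->; rewrite ?orbT.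
case: g => // k bf; exists [:: (msol_of f, k)]; split=> [z|w s] /=.
  by rewrite msol_fv_of.
by rewrite big_seq1 WE_bmsol //=; case: ifP; rewrite ?mul1r ?mul0r.
Qed.

Lemma definable_bmsol (f : formula K Sigma) : bmsol f ->
  definable (formula_fv f) (fun w s => WE f s).
Proof.
move=> bf; apply: definable_sub (definable_sat (msol_of f)) => [z|w s].
  by rewrite msol_fv_of.
by rewrite WE_bmsol.
Qed.

Lemma definable_All1 x (f : formula K Sigma) : bstep f ->
  definable (formula_fv (All1 x f)) (fun w s => WE (All1 x f) s).
Proof.
move=> /bstep_list [L [fvL eL]].
(* Initially no choice is made: the guard is true and the weight zero. *)
have [m [fvm em]] := step_monomial x L (MNot MFalse) 0.
apply: definable_sub (definable_monomial (m := m) (V := formula_fv (All1 x f)) _) => //.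
  move=> w s; rewrite -em /=; apply: eq_bigr => i _; by rewrite add0r eL.
by move=> z /fvm; rewrite /= !mem_filter => /andP[-> /fvL].
Qed.

Lemma definable_rmsol (f : formula K Sigma) : rmsol f ->
  definable (formula_fv f) (fun w s => WE f s).
Proof.
(* Settles the [bmsol] alternative of [rmsol] once for all constructors. *)
have bP (g : formula K Sigma) (b : bool) :
    (~~ bmsol g -> b -> definable (formula_fv g) (fun w s => WE g s)) ->
    bmsol g || b -> definable (formula_fv g) (fun w s => WE g s).
  move=> h; case: (boolP (bmsol g)) => [bg _|ng]; [exact: definable_bmsol | exact: h].
have subl (V V' : seq (nat + nat)) : {subset V <= V ++ V'}.
  by move=> z; rewrite mem_cat => ->.
have subr (V V' : seq (nat + nat)) : {subset V' <= V ++ V'}.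
  by move=> z; rewrite mem_cat orbC => ->.
elim: f => [k|a x|x y|x X|f _|f IHf g IHg|f IHf g IHg|x f IHf|X f IHf|x f _|X f _].
- by move=> _; exact: definable_const.
- by move=> _; exact: definable_bmsol.
- by move=> _; exact: definable_bmsol.
- by move=> _; exact: definable_bmsol.
(* A negated atom is already in [bmsol], so this alternative is void. *)
- by apply: bP => nb af; case: f nb af.
- move=> /= /andP[/IHf hf /IHg hg].
  apply: definable_add; first exact: definable_sub (subl _ _) _ hf.
  exact: definable_sub (subr _ _) _ hg.
- apply: bP => _ /andP[/IHf hf /IHg hg].
  apply: definable_mul; first exact: definable_sub (subl _ _) _ hf.
  exact: definable_sub (subr _ _) _ hg.
- by move=> /= /IHf; exact: definable_sum1.
- by move=> /= /IHf; exact: definable_sum2.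
- by apply: bP => _; exact: definable_All1.
- by apply: bP => nb bf; exact: definable_bmsol.
Qed.

(** * From the normal form to an expression *)

Fixpoint sum_expr N k (m : monomial K Sigma) : msoleval K Sigma :=
  if k is k'.+1
  then @ESum K Sigma [:: N] isT (MNot MFalse) (sum_expr N.+1 k' m)
  else EMono m.

Lemma sum_expr_fv V N k m :
  (forall z, z \in monomial_fv m -> scope V N k z) ->
  {subset msoleval_fv (sum_expr N k m) <= V}.
Proof.
elim: k N V => [|k IHk] N V fvm z /=.
  move=> /fvm; rewrite /scope; case: z => [x|X]; rewrite ?orbF // addn0.
  by rewrite andbC; case: ltngtP; rewrite ?orbF.
(* Inside the outermost sum, [N] counts as an ambient variable. *)
rewrite mem_filter inE => /andP[zN] /(IHk _ (inr N :: V)).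
rewrite inE (negbTE zN); apply=> y /fvm /orP[yV|]; rewrite /scope inE.
  by rewrite yV orbT.
case: y => // Y /andP[]; rewrite leq_eqVlt => /orP[/eqP ->|NY]; first by rewrite eqxx.
by rewrite -addSnnS NY => ->; rewrite orbT.
Qed.

(** Stated for pointwise equal assignments, since [updn] on a one-element tuple and [upd2] give
    different functions with the same values. *)
Lemma E_sum_expr N k m w (s s' : assignment w) : agree predT s s' ->
  E (sum_expr N k m) s = sum_sets N k (eval_monomial m) s'.
Proof.
elim: k N s s' => [|k IHk] N s s' h /=.
  by apply: eval_monomial_agree; apply: agree_sub h.
rewrite (reindex (fun A : {set pos w} => [tuple A])) /=; last first.
  exists (fun t : 1.-tuple {set pos w} => thead t) => [A _ | t _].
    by rewrite theadE.
  by case/tupleP: t => A t; apply: val_inj; rewrite theadE (tuple0 t).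
apply: eq_bigr => A _; apply: IHk; case: h => h1 h2.
split=> [x|X] _ /=; first exact: h1.
by rewrite inE eq_sym; case: eqP => //= _; apply: h2.
Qed.

End Definable.

Theorem theorem16 (K : comPzSemiRingType) (Sigma : finType)
    (f : formula K Sigma) (hf : rmsol f) :
  exists t : msoleval K Sigma,
    {subset msoleval_fv t <= formula_fv f} /\
    forall (w : seq Sigma) (s : assignment w), WE f s = E t s.
Proof.
have [N0 /(_ N0 (leqnn _)) [k [m [fvm em]]]] := definable_rmsol hf.
exists (sum_expr N0 k m); split; first exact: sum_expr_fv.
by move=> w s; rewrite em; symmetry; apply: E_sum_expr.
Qed.
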